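(* Let $T$ be an ergodic, invertible, measure-preserving map of a standard probability space $(X,\mathcal B,\mu)$, and let $f\in L^1(X,\mathcal B,\mu)$ be real-valued and not a constant function (i.e. not $\mu$-a.e. equal to a constant). Then for $\mu$-a.e. $x\in X$ the sequence of averages $\big(\mathbb A_{[N]}f(T^nx)\big)_{N\ge 1}$ is non-monotone; that is, for $\mu$-a.e. $x$ it is neither the case that $\mathbb A_{[N]}f(T^nx)\ge \mathbb A_{[N+1]}f(T^nx)$ for all sufficiently large $N$, nor the case that $\mathbb A_{[N]}f(T^nx)\le \mathbb A_{[N+1]}f(T^nx)$ for all sufficiently large $N$.
   Context: For $N\ge 1$, $\mathbb A_{[N]}f(T^nx)=\frac1N\sum_{n=1}^{N}f(T^nx)$. A sequence of measurable functions $(g_N)$ on $X$ is called non-monotone if there is no set $M$ with $\mu(M)>0$ such that for every $x\in M$ either $g_N(x)\ge g_{N+1}(x)$ for all large $N$ or $g_N(x)\le g_{N+1}(x)$ for all large $N$. *)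

(* Defs.v *)
From HB Require Import structures.
From mathcomp Require Import all_boot all_order all_algebra.
From mathcomp Require Import all_classical all_reals all_analysis.
Set Implicit Arguments.
Unset Strict Implicit.
Unset Printing Implicit Defensive.
Import Order.TTheory GRing.Theory Num.Theory.
Import numFieldNormedType.Exports.
Local Open Scope classical_set_scope.
Local Open Scope ring_scope.

Definition separable (Y : topologicalType) : Prop :=
  exists D : set Y, countable D /\ dense D.

(* Y carries a metric already known to be complete; Hausdorff turns the
   pseudometric into a metric. *)
Definition polish (R : realType) (Y : completePseudoMetricType R) : Prop :=
  hausdorff_space Y /\ separable Y.

Definition borel (Y : topologicalType) : set (set Y) := <<s @open Y >>.

(* (X, P) is, after discarding a null set, a Polish space with a Borel
   probability measure.  The measurable sets may be the Borel sets, their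
   P-completion or anything in between, and the exceptional null set is
   arbitrary: this covers both the convention "standard Borel space with a
   probability measure" (X0 = setT, B1 = B2) and Rokhlin's convention of
   complete Lebesgue spaces. *)
Definition standard_probability_space (R : realType) (d : measure_display)
    (X : measurableType d) (P : probability X R) : Prop :=
  exists (Y : completePseudoMetricType R) (X0 : set X) (phi : X -> Y),
    [/\ polish Y,
        measurable X0 /\ P X0 = 1%E,
        set_bij X0 [set: Y] phi,
        forall B, borel B -> measurable (X0 `&` phi @^-1` B) &
        forall A, measurable A -> A `<=` X0 ->
          exists B1 B2 : set Y,
            [/\ borel B1, borel B2,
                X0 `&` phi @^-1` B1 `<=` A,
                A `<=` X0 `&` phi @^-1` B2 &
                P (X0 `&` phi @^-1` (B2 `\` B1)) = 0%E]].

Definition measure_preserving (R : realType) (d : measure_display)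
    (X : measurableType d) (P : probability X R) (T : X -> X) : Prop :=
  measurable_fun [set: X] T /\
  forall A, measurable A -> P (T @^-1` A) = P A.

Definition invertible (d : measure_display) (X : measurableType d)
    (T : X -> X) : Prop :=
  exists S : X -> X, [/\ measurable_fun [set: X] S, cancel T S & cancel S T].

Definition ergodic (R : realType) (d : measure_display)
    (X : measurableType d) (P : probability X R) (T : X -> X) : Prop :=
  forall A, measurable A -> T @^-1` A = A -> P A = 0%E \/ P A = 1%E.

(* The sum starts at n = 1.  At N = 0 the value is the junk value 0, which has
   no effect on properties of the sequence for large N. *)
Definition ergodic_average (R : realType) (X : Type) (T : X -> X) (f : X -> R)
    (N : nat) (x : X) : R :=
  N%:R^-1 * \sum_(1 <= n < N.+1) f (iter n T x).

Definition non_monotone (R : realType) (u : nat -> R) : Prop :=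
  ~ (\forall N \near \oo, u N.+1 <= u N) /\
  ~ (\forall N \near \oo, u N <= u N.+1).

(* Main.v *)
Require Import Defs.
From mathcomp Require Import all_boot all_order all_algebra.
From mathcomp Require Import all_classical all_reals all_analysis.
From mathcomp Require Import measurable_realfun.
Set Implicit Arguments.
Unset Strict Implicit.
Unset Printing Implicit Defensive.
Import Order.TTheory GRing.Theory Num.Theory.
Local Open Scope classical_set_scope.
Local Open Scope ring_scope.

(** With $y_n = f(T^n x)$ and $a_N$ the averages, $a_{N+1} \le a_N$ means
    $y_{N+1} \le a_N$.  By ergodicity, for a.e. $x$ every value $y_j$ is
    approached or exceeded infinitely often along the orbit.  Hence if $(a_N)$
    is nonincreasing from some point on, each late $a_N$ dominates all the
    $y_j$; but $a_N$ is the mean of $y_1, \dots, y_N$, so these are all equal.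
    The orbit then sees only one value of $f$, and by recurrence $f$ is a.e.
    constant.  The nondecreasing case follows by applying this to $-f$.  No
    convergence theorem for the averages is needed. *)

(** This says that the limit superior of [y] equals its supremum; thresholds [r] keep unbounded
    sequences free of extended values. *)
Definition upper_recurrent (R : realType) (y : nat -> R) : Prop :=
  forall (j m : nat) (r : R), r < y j -> exists2 n, (m <= n)%N & r < y n.

Lemma upper_recurrent_nonincreasing_mean (R : realType) (y : nat -> R) :
  upper_recurrent y ->
  (\forall N \near \oo, N.+1%:R^-1 * \sum_(1 <= n < N.+2) y n
                        <= N%:R^-1 * \sum_(1 <= n < N.+1) y n) ->
  forall j, (0 < j)%N -> y j = y 1.
Proof.
set a := fun N => N%:R^-1 * \sum_(1 <= n < N.+1) y n.
move=> ury [N0 _ aN0].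
have aS N : (N0 <= N)%N -> a N.+1 <= a N by move=> /aN0.
have ya N : (N0 <= N)%N -> (0 < N)%N -> y N.+1 <= a N.
  move=> N0N N_gt0; have := aS N N0N.
  have sumE : \sum_(1 <= n < N.+1) y n = N%:R * a N.
    by rewrite /a mulVKf// pnatr_eq0 -lt0n.
  rewrite {1}/a big_nat_recr//= sumE mulrC ler_pdivrMr ?ltr0Sn//.
  by rewrite -natr1 mulrDr mulr1 mulrC lerD2l.
have a_nincr m n : (N0 <= m)%N -> (m <= n)%N -> a n <= a m.
  move=> N0m /subnK <-; elim: (n - m)%N => // k IH.
  by rewrite addSn (le_trans _ IH)// aS// (leq_trans N0m)// leq_addl.
(* If [y j] exceeded [a m], recurrence would give some [n >= m] with [y n.+1 > a m], whereas
   [y n.+1 <= a n <= a m]. *)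
have y_le_a m j : (N0 <= m)%N -> (0 < m)%N -> y j <= a m.
  move=> N0m m_gt0; rewrite leNgt; apply/negP => /ury -/(_ m.+1)[[//|n]].
  rewrite ltnS => mn; apply/negP; rewrite -leNgt.
  by rewrite (le_trans _ (a_nincr _ _ N0m mn))// ya// (leq_trans _ mn).
have y_eq_a m j : (N0 <= m)%N -> (0 < j <= m)%N -> y j = a m.
  move=> N0m /andP[j_gt0 jm].
  have m_gt0 : (0 < m)%N by exact: leq_trans jm.
  have sum0 : \sum_(1 <= n < m.+1) (a m - y n) == 0.
    rewrite sumrB sumr_const_nat subn1/= -mulr_natl.
    by rewrite {1}/a mulVKf ?subrr// pnatr_eq0 -lt0n.
  move: sum0; rewrite psumr_eq0; last by move=> n _; rewrite subr_ge0 y_le_a.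
  move=> /allP/(_ j); rewrite mem_index_iota j_gt0 ltnS jm => /(_ isT)/=.
  by rewrite subr_eq0 => /eqP.
(* With [m = maxn N0 j], both indices [1] and [j] lie in the range averaged by [a m]. *)
move=> j j_gt0; have N0m := leq_maxl N0 j; have jm := leq_maxr N0 j.
by rewrite (y_eq_a _ _ N0m) ?j_gt0// -(y_eq_a _ 1 N0m)// (leq_trans j_gt0 jm).
Qed.

Lemma ae_forall_countable (R : realType) (d : measure_display)
    (X : measurableType d) (mu : {measure set X -> \bar R}) (I : countType)
    (Q : I -> X -> Prop) :
  (forall i, {ae mu, forall x, Q i x}) -> {ae mu, forall x i, Q i x}.
Proof.
move=> aeQ.
have : {ae mu, forall x n, if @unpickle I n is Some i then Q i x else True}.
  by apply: ae_foralln => n; case: unpickle => // ; exact: aeW.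
by apply: filterS => x Qx i; have := Qx (pickle i); rewrite pickleK.
Qed.

Section recurrence.
Context (R : realType) (d : measure_display) (X : measurableType d).
Variables (P : probability X R) (T : X -> X).
Hypotheses (mpT : measure_preserving P T) (ergT : ergodic P T).

Let measurable_preimage_iter A n :
  measurable A -> measurable (iter n T @^-1` A).
Proof.
move=> mA; elim: n => // n IH.
have -> : iter n.+1 T @^-1` A = T @^-1` (iter n T @^-1` A).
  by apply/funext => x; rewrite /preimage/= -iterSr.
by rewrite -[X in measurable X]setTI; exact: mpT.1.
Qed.

Let measure_preimage_iter A n : measurable A -> P (iter n T @^-1` A) = P A.
Proof.
move=> mA; elim: n => // n IH.
have -> : iter n.+1 T @^-1` A = T @^-1` (iter n T @^-1` A).
  by apply/funext => x; rewrite /preimage/= -iterSr.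
by rewrite mpT.2 ?IH//; exact: measurable_preimage_iter.
Qed.

(** If [A] is null, so are its countably many preimages. Otherwise the set of points visiting [A]
    infinitely often is invariant and has measure at least [P A > 0], hence measure 1 by
    ergodicity. *)
Lemma ae_avoid_or_recur A : measurable A ->
  {ae P, forall x, (P A = 0%E /\ forall n, ~ A (iter n T x)) \/
                   forall m, exists2 n, (m <= n)%N & A (iter n T x)}.
Proof.
move=> mA; have mF n := measurable_preimage_iter n mA.
have [PA0|/eqP PA0] := eqVneq (P A) 0%E.
  suff : {ae P, forall x n, ~ A (iter n T x)}.
    by apply: filterS => x nAx; left.
  apply: ae_foralln => n.
  have : P.-negligible (iter n T @^-1` A).
    by apply/negligibleP; [exact: mF|exact: etrans (measure_preimage_iter n mA) PA0].
  by apply: negligibleS => x /contrapT.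
pose F n := iter n T @^-1` A.
have mbigcup n : measurable (\bigcup_(k >= n) F k).
  by apply: bigcup_measurable => k _; exact: mF.
have mE : measurable (lim_sup_set F).
  by apply: bigcap_measurable => [|n _]; [exists 0%N|exact: mbigcup].
(* Visits of [T x] at time [k] are visits of [x] at time [k.+1]. For the converse inclusion, asking
   for a visit after [n.+1] rules out time 0. *)
have TE : T @^-1` lim_sup_set F = lim_sup_set F.
  apply/seteqP; split => x /= Ex n _.
    by have [k /= nk Fk] := Ex n I; exists k.+1; [exact: leqW|rewrite /F/= -iterS iterSr].
  have [[//|k] /= nk Fk] := Ex n.+1 I.
  by exists k => //=; rewrite /F/= -iterSr.
(* The tail unions decrease to the limit superior, and the [n]-th one contains [F n], which has
   measure [P A]. *)
have PAE : (P A <= P (lim_sup_set F))%E.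
  have cvgE : P (\bigcup_(k >= n) F k) @[n --> \oo] --> P (lim_sup_set F).
    apply: lim_sup_set_cvg => //.
    by rewrite (le_lt_trans (probability_le1 P _)) ?ltry.
  rewrite -(cvg_lim _ cvgE)//; apply: lime_ge; first exact: cvgP cvgE.
  apply: nearW => n; rewrite -(measure_preimage_iter n mA).
  apply: le_measure; rewrite ?inE//.
  by move=> x Fx; exists n => /=.
have PE1 : P (lim_sup_set F) = 1%E.
  have [PE0|//] := ergT mE TE.
  by case: PA0; apply/eqP; rewrite eq_le measure_ge0 andbT -PE0.
have : P.-negligible (~` lim_sup_set F).
  apply/negligibleP; first exact: measurableC.
  by have := probability_setC P mE; rewrite PE1 subee.
apply: negligibleS => x; apply: contra_not => Ex; right => m.
by have [n /= mn Fn] := Ex m I; exists n.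
Qed.

(** Rational thresholds suffice and leave only countably many null sets: for [q] between [r] and the
    value at time [j], that visit excludes the avoiding alternative. *)
Lemma ae_upper_recurrent (f : X -> R) : measurable_fun setT f ->
  {ae P, forall x, upper_recurrent (fun n => f (iter n T x))}.
Proof.
move=> mf.
have /ae_forall_countable : forall q : rat, {ae P, forall x,
    (P [set y | (ratr q : R) < f y] = 0%E /\ forall n, ~ ratr q < f (iter n T x)) \/
    forall m, exists2 n, (m <= n)%N & ratr q < f (iter n T x)}.
  move=> q; apply: ae_avoid_or_recur.
  have := mf measurableT _ (measurable_itv `](ratr q : R), +oo[).
  by rewrite setTI set_itvoy.
apply: filterS => x visit j m r /rat_in_itvoo[q].
rewrite in_itv/= => /andP[rq qf].
have [[_ /(_ j)//]|/(_ m)[n mn qn]] := visit q.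
by exists n => //; exact: lt_trans qn.
Qed.

(** One generic point whose orbit shows a single value [c] from time 1 on already forces [f] to be
    a.e. [c]: each set [f > q] or [f <= q] that misses [c] is not visited after time 0, so it is
    null. *)
Lemma ae_orbit_not_constant (f : X -> R) : measurable_fun setT f ->
  ~ (exists c, {ae P, forall x, f x = c}) ->
  {ae P, forall x, ~ forall j, (0 < j)%N -> f (iter j T x) = f (iter 1 T x)}.
Proof.
move=> mf nconstf.
have mgt (r : R) : measurable [set y | r < f y].
  by have := mf measurableT _ (measurable_itv `]r, +oo[); rewrite setTI set_itvoy.
have mle (r : R) : measurable [set y | f y <= r].
  by have := mf measurableT _ (measurable_itv `]-oo, r]); rewrite setTI set_itvNyc.
have visit_gt := ae_forall_countable
  (fun q : rat => ae_avoid_or_recur (mgt (ratr q))).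
have visit_le := ae_forall_countable
  (fun q : rat => ae_avoid_or_recur (mle (ratr q))).
apply: filterS2 visit_gt visit_le => x gtx lex fx; apply: nconstf.
exists (f (iter 1 T x)); set c := f _.
(* Almost every [f y] makes the same cut in the rationals as [c], so equals [c] by density. Visits
   are taken from time 1 on because [fx] says nothing about time 0. *)
have : {ae P, forall y (q : rat), ratr q < f y <-> ratr q < c}.
  apply: ae_forall_countable => q; have [qc|cq] := ltP (ratr q) c.
    have [[P0 _]|/(_ 1%N)[n n_gt0 /=]] := lex q; last first.
      by rewrite fx// leNgt qc.
    have /negligibleP : measurable [set y | f y <= ratr q] by [].
    move=> /(_ _ P)/iffRL/(_ P0); apply: negligibleS => y /=.
    by rewrite leNgt => qfy; apply/negP => qy; apply: qfy.
  have [[P0 _]|/(_ 1%N)[n n_gt0 /=]] := gtx q; last first.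
    by rewrite fx// ltNge cq.
  have /negligibleP : measurable [set y | ratr q < f y] by [].
  move=> /(_ _ P)/iffRL/(_ P0); apply: negligibleS => y /=.
  by apply: contra_notP => qy; split => // /lt_geF; rewrite cq.
apply: filterS => y qy; have [/rat_in_itvoo[q]|/rat_in_itvoo[q]|//] := ltgtP (f y) c.
  by rewrite in_itv/= => /andP[yq /qy /(lt_trans yq)]; rewrite ltxx.
by rewrite in_itv/= => /andP[cq /qy /(lt_trans cq)]; rewrite ltxx.
Qed.

Lemma ae_not_eventually_nonincreasing (f : X -> R) : measurable_fun setT f ->
  ~ (exists c, {ae P, forall x, f x = c}) ->
  {ae P, forall x, ~ \forall N \near \oo,
    ergodic_average T f N.+1 x <= ergodic_average T f N x}.
Proof.
move=> mf nconstf.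
apply: filterS2 (ae_upper_recurrent mf) (ae_orbit_not_constant mf nconstf).
move=> x urx nconstx nincr; apply: nconstx.
exact: upper_recurrent_nonincreasing_mean.
Qed.

End recurrence.

Theorem proposition3p1 (R : realType) (d : measure_display)
  (X : measurableType d) (P : probability X R) (T : X -> X) (f : X -> R)
  (stdP : standard_probability_space P)
  (invT : invertible T)
  (mpT : measure_preserving P T)
  (ergT : ergodic P T)
  (intf : P.-integrable [set: X] (EFin \o f))
  (nconstf : ~ exists c : R, {ae P, forall x, f x = c}) :
  {ae P, forall x, non_monotone (fun N => ergodic_average T f N x)}.
Proof.
have mf : measurable_fun setT f by apply/measurable_EFinP; exact: measurable_int intf.
have nconstNf : ~ exists c : R, {ae P, forall x, - f x = c}.
  move=> [c fc]; apply: nconstf; exists (- c); apply: filterS fc => x <-.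
  by rewrite opprK.
have avgN N x : ergodic_average T (fun y => - f y) N x = - ergodic_average T f N x.
  by rewrite /ergodic_average sumrN mulrN.
have mNf : measurable_fun setT (fun x => - f x) by exact: measurable_funN.
have fN := ae_not_eventually_nonincreasing mpT ergT mf nconstf.
have NfN := ae_not_eventually_nonincreasing mpT ergT mNf nconstNf.
apply: filterS2 fN NfN => x nincr ndecr; split => // H; apply: ndecr.
by apply: filterS H => N; rewrite !avgN lerN2.
Qed.
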